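(* Let $w$ be a finite good word. Then we can write $w=a\,\delta(u)\,b$, where $a\in\{\epsilon,0,1\}$, $b\in\{\epsilon,0\}$, and $u$ is a good word. If $|w|\ge 4$, this factorization is unique. If $\mathbf{w}$ is a one-sided infinite good word, then we can write $\mathbf{w}=a\,\delta(\mathbf{u})$ for some one-sided infinite good word $\mathbf{u}$, where $a\in\{\epsilon,0,1\}$.
   Context: Words are over the alphabet $\{0,1\}$; $\epsilon$ is the empty word and $|w|$ the length of $w$. A factor of a (finite or infinite) word is a finite contiguous subword. A morphism $g:\{0,1\}^*\to\{0,1\}^*$ is non-erasing if $g(0)$ and $g(1)$ are both non-empty. A word $w$ encounters a pattern $p\in\{0,1\}^*$ if $g(p)$ is a factor of $w$ for some non-erasing morphism $g:\{0,1\}^*\to\{0,1\}^*$. A (finite or one-sided infinite) binary word is called good if it contains neither $11$ nor $1001$ as a factor, and encounters neither of the patterns $0000$ and $00010100$. The morphism $\delta$ is given by $\delta(0)=01$, $\delta(1)=00$, and is extended letterwise to one-sided infinite words. *)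

(* Defs.v *)
From mathcomp Require Import all_boot.

Set Implicit Arguments.
Unset Strict Implicit.
Unset Printing Implicit Defensive.

(* The letters 0 and 1 are the booleans false and true. *)
Declare Scope letter_scope.
Delimit Scope letter_scope with letter.
Notation "0" := false : letter_scope.
Notation "1" := true : letter_scope.

Definition word := seq bool.
Definition infword := nat -> bool.

(* A morphism for concatenation sends the empty word to itself, so this is all
   that is required of a morphism of free monoids. *)
Definition word_morphism (g : word -> word) : Prop :=
  {morph g : u v / u ++ v}.

Definition non_erasing (g : word -> word) : Prop :=
  g [:: 0%letter] <> [::] /\ g [:: 1%letter] <> [::].

Definition factor (w v : word) : Prop := infix v w.

Definition inf_factor (w : infword) (v : word) : Prop :=
  exists i, v = mkseq (fun j => w (i + j)) (size v).

(* Encountering a pattern and being good depend only on the set of factors, so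
   both are defined for a set F of words, to be instantiated with the factors
   of a finite or of an infinite word. *)
Definition encounters (F : word -> Prop) (p : word) : Prop :=
  exists g, [/\ word_morphism g, non_erasing g & F (g p)].

Definition good_factors (F : word -> Prop) : Prop :=
  [/\ ~ F [:: 1; 1]%letter,
      ~ F [:: 1; 0; 0; 1]%letter,
      ~ encounters F [:: 0; 0; 0; 0]%letter
    & ~ encounters F [:: 0; 0; 0; 1; 0; 1; 0; 0]%letter].

Definition good (w : word) : Prop := good_factors (factor w).
Definition inf_good (w : infword) : Prop := good_factors (inf_factor w).

Definition delta_letter (x : bool) : word :=
  if x then [:: 0; 0]%letter else [:: 0; 1]%letter.

Definition delta (u : word) : word := flatten [seq delta_letter x | x <- u].

(* Every block has length 2, so position n lies in the image of letter n./2, at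
   offset odd n. *)
Definition inf_delta (u : infword) : infword :=
  fun n => nth false (delta_letter (u n./2)) (odd n).

Definition inf_cat (a : word) (w : infword) : infword :=
  fun n => if n < size a then nth false a n else w (n - size a).

Definition factorization (w a u b : word) : Prop :=
  [/\ a \in [:: [::]; [:: 0]; [:: 1]]%letter,
      b \in [:: [::]; [:: 0]]%letter,
      good u
    & w = a ++ delta u ++ b].

(* Main.v *)
Require Import Defs.
From mathcomp Require Import all_boot zify.

Set Implicit Arguments.
Unset Strict Implicit.
Unset Printing Implicit Defensive.

(** In a good word consecutive 1s are at distance 2 or 4: 11 and 1001 exclude
    the distances 1 and 3, and 0000 excludes longer gaps.  So all 1s have the
    same parity, and cutting the word into blocks of length 2 ending at that
    parity yields only the blocks 01 and 00.  The preimage is again good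
    because delta(11) = 0000 and delta(1001) = 00010100 are forbidden, and an
    occurrence of a pattern under g becomes one under delta \o g. *)

Lemma delta_cat : word_morphism delta.
Proof. by move=> u v; rewrite /delta map_cat flatten_cat. Qed.

Lemma delta_cons x u : delta (x :: u) = [:: false, ~~ x & delta u].
Proof. by case: x. Qed.

Lemma size_delta u : size (delta u) = (size u).*2.
Proof. by elim: u => // x u IH; rewrite delta_cons /= IH. Qed.

Lemma nth_delta u j : j < size (delta u) ->
  nth false (delta u) j = nth false (delta_letter (nth false u j./2)) (odd j).
Proof.
elim: u j => // x u IH [|[|j]]; rewrite delta_cons; [by case: x..|].
by rewrite /= !ltnS negbK => /IH.
Qed.

Lemma delta_inj : injective delta.
Proof.
by elim=> [|x u IH] [|y v]; rewrite ?delta_cons // => -[/negb_inj-> /IH->].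
Qed.

Lemma encounters_self (F : word -> Prop) p : F p -> encounters F p.
Proof. by move=> Fp; exists id. Qed.

Lemma encounters_delta (F G : word -> Prop) p :
  (forall v, F v -> G (delta v)) -> encounters F p -> encounters G p.
Proof.
move=> FG [g [gM [g0 g1] Fgp]]; exists (delta \o g); split; last exact: FG.
  by move=> u v /=; rewrite gM delta_cat.
by split=> /(congr1 size); rewrite /= size_delta => /eqP;
  rewrite double_eq0 size_eq0 => /eqP.
Qed.

(** Stated for sets of factors so that it gives goodness of the preimage for finite and infinite
    words alike. *)
Lemma good_factors_delta (F G : word -> Prop) :
  (forall v, F v -> G (delta v)) -> good_factors G -> good_factors F.
Proof.
move=> FG [_ _ G3 G4]; split.
- by move/FG/encounters_self.
- by move/FG/encounters_self.
- by move/(encounters_delta FG).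
- by move/(encounters_delta FG).
Qed.

(* The factors of f are only required up to its last 1, so that the lemma also
   applies to a finite word padded with 0s. *)
Lemma ones_same_parity (F : word -> Prop) (f : infword) :
  good_factors F ->
  (forall i n j, f j -> i + n <= j.+1 -> F (mkseq (fun k => f (i + k)) n)) ->
  forall i j, f i -> f j -> odd i = odd j.
Proof.
move=> [F1 F2 F3 _] Ff.
(* Strong induction on the distance [d]: a 1 at an even distance [k] in between reduces [d] to
   [d - k]. *)
have step i d : f i -> f (i + d) -> ~~ odd d.
  elim/ltn_ind: d i => d IH i fi fd.
  have IHk k : 0 < k < d -> f (i + k) -> ~~ odd k -> ~~ odd d.
    case/andP=> k0 kd fk ek; have := IH (d - k) _ (i + k) fk.
    by rewrite oddB ?(ltnW kd) // (negPf ek) addbF; apply;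
      [lia | rewrite -addnA subnKC ?(ltnW kd)].
  case: d fd IH IHk => [//|[|[//|d]]] fd IH IHk.
    by case: F1; have := Ff i 2 _ fd; rewrite /mkseq /= addn0 fi fd; apply; lia.
  have nf1 : f (i + 1) = false.
    apply/negP=> f1; case: F1.
    by have := Ff i 2 _ f1; rewrite /mkseq /= addn0 fi f1; apply; lia.
  case f2: (f (i + 2)); first exact: (IHk 2).
  case: d fd IH IHk => [|[//|d]] fd IH IHk.
    case: F2; have := Ff i 4 _ fd.
    by rewrite /mkseq /= addn0 fi nf1 f2 fd; apply; lia.
  (* Here the distance is at least 5. A 1 at distance 3 would contradict the induction
     hypothesis. *)
  case f3: (f (i + 3)).
    by have := IH 3 isT i fi f3.
  case f4: (f (i + 4)); first exact: (IHk 4).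
  (* The four letters after position [i] are all 0, and they precede the 1 at the far end. *)
  case: F3; apply: encounters_self; have := Ff i.+1 4 _ fd.
  rewrite /mkseq /= !addSnnS nf1 f2 f3 f4; apply; lia.
move=> i j; wlog le_ij : i j / i <= j => [H fi fj|].
  by case/orP: (leq_total i j) => /H->.
move=> fi fj; have := step i (j - i) fi; rewrite subnKC // oddB // => /(_ fj).
by case: (odd i); case: (odd j).
Qed.

Lemma factor_mkseq (w : word) i n : i + n <= size w ->
  factor w (mkseq (fun k => nth false w (i + k)) n).
Proof.
move=> le_w; suff -> : mkseq (fun k => nth false w (i + k)) n = take n (drop i w).
  exact: infix_trans (infix_take _ _) (infix_drop _ _).
apply: (@eq_from_nth _ false) => [|k]; rewrite size_mkseq.
  by rewrite size_takel // size_drop; lia.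
by move=> lt_k; rewrite nth_mkseq // nth_take // nth_drop.
Qed.

Lemma good_ones_same_parity w i j : good w ->
  nth false w i -> nth false w j -> odd i = odd j.
Proof.
move=> gw; apply: (ones_same_parity (f := nth false w) gw) => {}i n {}j wj le_j.
(* The default letter of [nth] is 0, so a position carrying 1 lies inside [w]. *)
apply/factor_mkseq/(leq_trans le_j); rewrite ltnNge.
by apply: contraL wj => /(nth_default false)->.
Qed.

(** Each block of two letters starts at an even position, hence with 0, so it is the image of the
    negation of its second letter. A leftover single letter is 0 and becomes [b]. *)
Lemma odd_ones_delta (v : word) : (forall i, nth false v i -> odd i) ->
  exists u b, b \in [:: [::]; [:: false]] /\ v = delta u ++ b.
Proof.
elim/ltn_ind: {v}_.+1 {-2}v (ltnSn (size v)) => n IH [|[] [|y v]] le_n odd_v;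
  try by have := odd_v 0 isT.
- by exists [::], [::].
- by exists [::], [:: false].
have [|i vi|u [b [b_in ->]]] := IH (size v).+1 _ v (leqnn _).
- exact: ltn_trans (ltnSn _) le_n.
- by have := odd_v i.+2 vi; rewrite /= negbK.
by exists (~~ y :: u), b; split; rewrite // delta_cons negbK.
Qed.

Lemma good_factorization w : good w -> exists a u b, factorization w a u b.
Proof.
move=> gw.
suff [a [u [b [a_in b_in w_eq]]]] : exists a u b,
    [/\ a \in [:: [::]; [:: false]; [:: true]], b \in [:: [::]; [:: false]]
      & w = a ++ delta u ++ b].
  exists a, u, b; split=> //; apply: good_factors_delta gw => v /infixP[s [t u_eq]].
  apply/infixP; exists (a ++ delta s), (delta t ++ b).
  by rewrite w_eq u_eq !delta_cat -!catA.
(* If some 1 is at an even position, all are, and cutting off the first letter as [a] moves the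
   others to odd positions; otherwise [a] is empty. *)
case: (boolP (has (fun i => nth false w i && ~~ odd i) (iota 0 (size w)))).
  case/hasP=> p _ /andP[wp even_p].
  have even_w i : nth false w i -> ~~ odd i.
    by move/(good_ones_same_parity gw wp) => <-.
  case: w gw wp even_w => [|x v] _ wp even_w; first by rewrite nth_nil in wp.
  have [|u [b [b_in ->]]] := @odd_ones_delta v.
    by move=> i vi; have := even_w i.+1 vi; rewrite /= negbK.
  by exists [:: x], u, b; split=> //; case: x {wp even_w}.
move/hasPn=> odd_w; have [i wi|u [b [b_in ->]]] := @odd_ones_delta w.
  have lt_i : i < size w.
    by rewrite ltnNge; apply: contraL wi => /(nth_default false)->.
  by have := odd_w i; rewrite mem_iota wi /= negbK; apply.
by exists [::], u, b.
Qed.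

(* Every block starts with 0, and each of these letters starts a block (or is b
   or b') in one of the two shifted factorizations. *)
Lemma delta_shifted_prefix x u b u' b' :
  b \in [:: [::]; [:: false]] -> b' \in [:: [::]; [:: false]] ->
  delta u ++ b = x :: delta u' ++ b' -> 4 <= size (delta u ++ b) ->
  exists v, delta u ++ b = [:: false, false, false, false & v].
Proof.
rewrite !inE => b_in b'_in.
case: u => [|y [|z u]]; rewrite ?delta_cons /=.
- by case/orP: b_in => /eqP->.
- by case/orP: b_in => /eqP->.
case: u' => [|y' [|z' u']]; rewrite ?delta_cons /=.
- by case/orP: b'_in => /eqP->.
- case/orP: b'_in => /eqP-> //= -[_ -> _ -> _] _; by exists (delta u ++ b).
- by case=> _ -> _ -> _ _; exists (delta u ++ b).
Qed.

Lemma good_no_0000 w v : good w -> w <> [:: false, false, false, false & v].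
Proof.
move=> [_ _ w3 _] w_eq; case: w3; apply: encounters_self; rewrite w_eq.
by apply/infixP; exists [::], v.
Qed.

(** The parity of the total length fixes the length of [b], hence that of [u]; then [delta] is
    injective. *)
Lemma delta_cat_inj u b u' b' :
  b \in [:: [::]; [:: false]] -> b' \in [:: [::]; [:: false]] ->
  delta u ++ b = delta u' ++ b' -> u = u' /\ b = b'.
Proof.
move=> b_in b'_in eq_ub; have /(congr1 size) := eq_ub.
rewrite !size_cat !size_delta => size_eq.
have size_b : size u = size u'.
  by move: b_in b'_in size_eq; rewrite !inE => /orP[] /eqP-> /orP[] /eqP-> /=; lia.
move/eqP: eq_ub; rewrite eqseq_cat ?size_delta ?size_b //.
by case/andP=> /eqP/delta_inj-> /eqP->.
Qed.

Lemma good_factorization_unique w a u b a' u' b' : good w -> 4 <= size w ->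
  factorization w a u b -> factorization w a' u' b' ->
  [/\ a = a', u = u' & b = b'].
Proof.
move=> gw w4 [a_in b_in _ w_eq] [a'_in b'_in _ w_eq'].
have eq_ab : a ++ delta u ++ b = a' ++ delta u' ++ b' by rewrite -w_eq.
(* Factorizations with [a] of different lengths would force the prefix 0000. *)
have shifted c x v d v' d' : c = [::] -> d \in [:: [::]; [:: false]] ->
    d' \in [:: [::]; [:: false]] -> w = c ++ delta v ++ d ->
    w = x :: delta v' ++ d' -> False.
  move=> -> d_in d'_in w_v w_v'; rewrite w_v in w_v' w4.
  have [t t_eq] := delta_shifted_prefix d_in d'_in w_v' w4.
  by apply: (good_no_0000 gw (v := t)); rewrite w_v.
have size_le1 c : c \in [:: [::]; [:: false]; [:: true]] -> size c <= 1.
  by rewrite !inE => /or3P[] /eqP->.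
case: a {a_in} (size_le1 a a_in) w_eq eq_ab => [|x []] // _ w_eq;
  case: a' {a'_in} (size_le1 a' a'_in) w_eq' => [|x' []] // _ w_eq'.
- by move=> /(delta_cat_inj b_in b'_in)[-> ->].
- by case: (shifted [::] x' u b u' b').
- by case: (shifted [::] x u' b' u b).
- by case=> -> /(delta_cat_inj b_in b'_in)[-> ->].
Qed.

Lemma inf_factor_delta a u w v : w =1 inf_cat a (inf_delta u) ->
  inf_factor u v -> inf_factor w (delta v).
Proof.
(* Letter [i] of [u] has its block starting here. *)
move=> w_eq [i v_eq]; exists (size a + i.*2).
apply: (@eq_from_nth _ false) => [|k lt_k]; first by rewrite size_mkseq.
rewrite nth_mkseq // nth_delta // w_eq /inf_cat -addnA ltnNge leq_addr /=.
rewrite addKn /inf_delta oddD odd_double halfD odd_double /= doubleK add0n.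
rewrite {1}v_eq nth_mkseq //.
by move: lt_k; rewrite size_delta; lia.
Qed.

Lemma inf_good_ones_same_parity w i j : inf_good w -> w i -> w j -> odd i = odd j.
Proof.
by move=> gw; apply: (ones_same_parity gw) => {}i n {}j _ _; exists i; rewrite size_mkseq.
Qed.

Lemma inf_delta_ones_odd (w : infword) : (forall i, w i -> odd i) ->
  w =1 inf_delta (fun n => ~~ w n.*2.+1).
Proof.
move=> odd_w n; rewrite /inf_delta -{1}[n]odd_double_half.
case: (odd n) => /=; first by case: (w _).
rewrite add0n; have := odd_w n./2.*2; rewrite odd_double.
by do 2 case: (w _) => //; move=> /(_ isT).
Qed.

Lemma inf_good_factorization w : inf_good w ->
  exists a u, [/\ a \in [:: [::]; [:: false]; [:: true]], inf_good u
                & w =1 inf_cat a (inf_delta u)].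
Proof.
move=> gw.
suff [a [u [a_in w_eq]]] : exists a u,
    a \in [:: [::]; [:: false]; [:: true]] /\ w =1 inf_cat a (inf_delta u).
  exists a, u; split=> //; apply: good_factors_delta gw => v.
  exact: inf_factor_delta.
(* Some 1 occurs among the first four letters, since 0000 is excluded; its parity is that of all
   1s. *)
have [p wp] : exists p, w p.
  case: gw => _ _ w3 _.
  case w0: (w 0); first by exists 0.
  case w1: (w 1); first by exists 1.
  case w2: (w 2); first by exists 2.
  case w3': (w 3); first by exists 3.
  by case: w3; apply: encounters_self; exists 0; rewrite /mkseq /= !add0n w0 w1 w2 w3'.
have w_par i (wi : w i) := inf_good_ones_same_parity gw wi wp.
case: (boolP (odd p)) => [odd_p|even_p].
  exists [::], (fun n => ~~ w n.*2.+1); split=> // n; rewrite /inf_cat subn0.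
  by apply: inf_delta_ones_odd => i /w_par->.
(* After the first letter, block [n] occupies positions [2n+1] and [2n+2], and its second letter
   determines the preimage. *)
exists [:: w 0], (fun n => ~~ w n.*2.+2); split; first by case: (w 0).
case=> [//|n]; rewrite /inf_cat /= subn1 /=.
apply: (@inf_delta_ones_odd (w \o succn)) => i /w_par /=.
by rewrite (negPf even_p) => /negbFE.
Qed.

Theorem theorem1p6 :
  (forall w : word, good w ->
     (exists a u b : word, factorization w a u b) /\
     (4 <= size w ->
        forall a u b a' u' b' : word,
          factorization w a u b -> factorization w a' u' b' ->
          [/\ a = a', u = u' & b = b'])) /\
  (forall w : infword, inf_good w ->
     exists (a : word) (u : infword),
       [/\ a \in [:: [::]; [:: 0]; [:: 1]]%letter,
           inf_good u
         & w =1 inf_cat a (inf_delta u)]).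
Proof.
split=> [w gw|]; last exact: inf_good_factorization.
split=> [|w4 a u b a' u' b']; first exact: good_factorization.
exact: good_factorization_unique.
Qed.
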